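(* Let $n\ge0$ be an integer and $\delta\ge0$. A metric space $X$ is $(n,\delta)$-hyperbolic if and only if its injective hull $E(X)$ is $(n,\delta)$-hyperbolic.
   Context: Let $I_n=\{\pm1,\ldots,\pm(n+1)\}$. A metric space $(X,d)$ is $(n,\delta)$-hyperbolic if for every family $(x_i)_{i\in I_n}$ of points of $X$ there is a permutation $\alpha\ne-\mathrm{id}$ of $I_n$ with $\sum_{i\in I_n}d(x_i,x_{-i})\le\sum_{i\in I_n}d(x_i,x_{\alpha(i)})+2\delta$. The injective hull $E(X)$ of a metric space $(X,d)$ is the set of all functions $f:X\to\mathbb{R}$ that are minimal, in the pointwise order, among the functions satisfying $f(x)+f(y)\ge d(x,y)$ for all $x,y\in X$; it is endowed with the (finite) metric $\|f-g\|_\infty=\sup_X|f-g|$, and $x\mapsto d(\cdot,x)$ is the canonical isometric embedding $X\to E(X)$. *)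

(* Defs.v *)
From HB Require Import structures.
From mathcomp Require Import all_boot all_order all_algebra all_fingroup.
From mathcomp Require Import boolp classical_sets reals topology.
From mathcomp Require Import metric_structure.
From mathcomp Require Import lra.

Set Implicit Arguments.
Unset Strict Implicit.
Unset Printing Implicit Defensive.

Import Order.TTheory GRing.Theory Num.Theory.

Local Open Scope classical_set_scope.
Local Open Scope ring_scope.

(** The index set I_n = {±1, …, ±(n+1)}: the pair [(s, k)] with [k < n.+1]
    stands for [k + 1] if [s] is [false] and for [- (k + 1)] if [s] is [true]. *)
Definition signed_index (n : nat) : finType := (bool * 'I_n.+1)%type.

Definition sopp (n : nat) (i : signed_index n) : signed_index n :=
  (~~ i.1, i.2).

Lemma soppK (n : nat) : involutive (@sopp n).
Proof. by case=> s k; rewrite /sopp /= negbK. Qed.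

Definition sopp_perm (n : nat) : {perm signed_index n} :=
  perm (inv_inj (@soppK n)).

Definition hyperbolic (R : realType) (n : nat) (delta : R) (X : metricType R) :
    Prop :=
  forall x : signed_index n -> X,
  exists2 alpha : {perm signed_index n}, alpha != sopp_perm n &
    \sum_(i : signed_index n) mdist (x i) (x (sopp i)) <=
    \sum_(i : signed_index n) mdist (x i) (x (alpha i)) + 2 * delta.

Section InjectiveHull.
Context {R : realType}.

Definition dominates_dist (X : metricType R) (f : X -> R) : Prop :=
  forall x y, mdist x y <= f x + f y.

Definition extremal (X : metricType R) (f : X -> R) : Prop :=
  dominates_dist f /\
  forall g : X -> R, dominates_dist g -> (forall x, g x <= f x) -> g = f.

Definition injective_hull (X : metricType R) : Type :=
  {f : X -> R | extremal f}.

Variable X : metricType R.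
Implicit Types f g h : injective_hull X.

(** For empty [X], [sup set0 = 0] is the right value: the hull is a point. *)
Definition hull_dist f g : R := sup [set `|sval f x - sval g x| | x in setT].

Lemma extremal_lipschitz (f : X -> R) (x y : X) :
  extremal f -> f x <= f y + mdist x y.
Proof.
move=> [fd fmin]; rewrite leNgt; apply/negP => lt_fx.
pose g z := if z == x then f y + mdist x y else f z.
have fy0 : 0 <= f y by have := fd y y; rewrite mdistxx; lra.
have dxy0 : 0 <= mdist x y by exact: mdist_ge0.
have gxz z : mdist x z <= f y + mdist x y + f z.
  by have := metric_triangle x y z; have := fd y z; lra.
have gd : dominates_dist g.
  move=> u v; rewrite /g; case: eqP => [->|_]; case: eqP => [->|_] //.
  - by rewrite mdistxx; lra.
  - by rewrite metric_sym addrC; exact: gxz.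
have gf z : g z <= f z by rewrite /g; case: eqP => [->|//]; exact: ltW.
by have /(congr1 (@^~ x)) := fmin g gd gf; rewrite /g eqxx; lra.
Qed.

Lemma hull_diff_le f g (x y : X) :
  `|sval f y - sval g y| <= sval f x + sval g x.
Proof.
have := extremal_lipschitz y x (svalP f).
have := extremal_lipschitz y x (svalP g).
have [fd _] := svalP f; have [gd _] := svalP g.
by have := fd y x; have := gd y x; rewrite ler_norml; lra.
Qed.

Lemma le_hull_dist f g (x : X) : `|sval f x - sval g x| <= hull_dist f g.
Proof.
apply: ub_le_sup; last by exists x.
by exists (sval f x + sval g x) => _ [y _ <-]; exact: hull_diff_le.
Qed.

Lemma hull_dist_le f g (c : R) : 0 <= c ->
  (forall x, `|sval f x - sval g x| <= c) -> hull_dist f g <= c.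
Proof.
move=> c0 fgc; rewrite /hull_dist; set S := [set _ | _ in _].
have [->|/set0P S0] := eqVneq S set0; first by rewrite sup0.
by apply: ge_sup => // _ [x _ <-].
Qed.

Lemma hull_dist_ge0 f g : 0 <= hull_dist f g.
Proof.
rewrite /hull_dist; set S := [set _ | _ in _].
have [->|/set0P [_ [x _ _]]] := eqVneq S set0; first by rewrite sup0.
exact: le_trans (normr_ge0 _) (le_hull_dist f g x).
Qed.

Lemma hull_distxx f : hull_dist f f = 0.
Proof.
apply/eqP; rewrite eq_le hull_dist_ge0 andbT.
by apply: hull_dist_le => // x; rewrite subrr normr0.
Qed.

Lemma hull_dist_eq0 f g : hull_dist f g = 0 -> f = g.
Proof.
move=> fg0; apply: eq_sig_hprop => /=; first by move=> *; exact: Prop_irrelevance.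
apply/funext => x; apply/eqP; rewrite -subr_eq0 -normr_le0 -fg0.
exact: le_hull_dist.
Qed.

Lemma hull_dist_sym f g : hull_dist f g = hull_dist g f.
Proof.
by congr sup; apply/seteqP; split=> _ [x _ <-]; exists x => //; exact: distrC.
Qed.

Lemma hull_dist_triangle g f h : hull_dist f h <= hull_dist f g + hull_dist g h.
Proof.
apply: hull_dist_le => [|x]; first by rewrite addr_ge0 ?hull_dist_ge0.
apply: le_trans (ler_distD (sval g x) _ _) _.
by rewrite lerD ?le_hull_dist.
Qed.

HB.instance Definition _ := gen_eqMixin (injective_hull X).
HB.instance Definition _ := gen_choiceMixin (injective_hull X).
HB.instance Definition _ := isMetric.Build R (injective_hull X)
  hull_distxx hull_dist_eq0 hull_dist_sym hull_dist_triangle.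

End InjectiveHull.

(* Main.v *)
Require Import Defs.
From mathcomp Require Import all_boot all_order all_algebra.
From mathcomp Require Import reals topology metric_structure.
From mathcomp Require Import all_fingroup boolp lra.

(** Hyperbolicity passes to isometrically embedded spaces, in particular from
    [E(X)] to [X]. Conversely, for [f, g] in [E(X)] there are points [p, q] of
    [X] such that [p, f, g, q] lie almost on a geodesic:
    [f p + d(f, g) + g q <= d(p, q) + 2 * eps]. Choose such points for each pair
    [f_i, f_(-i)] and apply hyperbolicity of [X] to them: the terms [f_i (x_i)]
    occur equally often on both sides of the resulting inequality and cancel.
    As there are finitely many permutations, [eps] can be sent to [0]. *)

Set Implicit Arguments.
Unset Strict Implicit.
Unset Printing Implicit Defensive.

Import Order.TTheory GRing.Theory Num.Theory.

Local Open Scope ring_scope.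

Lemma hyperbolic_isometric (R : realType) (n : nat) (delta : R)
    (X Y : metricType R) (phi : X -> Y) :
  (forall x y, mdist (phi x) (phi y) = mdist x y) ->
  hyperbolic n delta Y -> hyperbolic n delta X.
Proof.
move=> phi_iso hypY x; have [alpha alphaN le_alpha] := hypY (phi \o x).
exists alpha => //; move: le_alpha.
by under eq_bigr do rewrite phi_iso; under [in leRHS]eq_bigr do rewrite phi_iso.
Qed.

Section Hull.
Context {R : realType} {X : metricType R}.
Implicit Types (x y p q : X) (f g : injective_hull X).

(** A dominating [g] below this function has [g x <= 0], and [mdist y x <= g y + g x] then forces
    equality. *)
Lemma mdist_extremal x : extremal (fun y => mdist y x).
Proof.
split=> [y z|g g_dom g_le]; first by rewrite (metric_sym z); exact: metric_triangle.
apply/funext => y; apply/eqP; rewrite eq_le g_le /=.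
by have := g_dom y x; have := g_le x; rewrite mdistxx; lra.
Qed.

Definition hull_embed x : injective_hull X :=
  exist (@extremal R X) _ (mdist_extremal x).

Lemma mdist_hull_embed x y : mdist (hull_embed x) (hull_embed y) = mdist x y.
Proof.
apply/eqP; rewrite eq_le; apply/andP; split.
  apply: hull_dist_le => [|z /=]; first exact: mdist_ge0.
  have := metric_triangle z y x; have := metric_triangle z x y.
  by rewrite (metric_sym y x) ler_norml; lra.
have := le_hull_dist (hull_embed x) (hull_embed y) x.
by rewrite /= mdistxx sub0r normrN ger0_norm // mdist_ge0.
Qed.

(** Otherwise [f] could be lowered at [x] alone, against minimality. The amount is [eps / 2] because
    the pair [(x, x)] counts it twice. *)
Lemma extremal_approx (f : X -> R) x (eps : R) : extremal f -> 0 < eps ->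
  exists y, f x + f y < mdist x y + eps.
Proof.
move=> [f_dom f_min] eps0; apply/not_existsP => far.
have {}far y : mdist x y + eps <= f x + f y.
  by rewrite leNgt; apply/negP; exact: far.
pose g z := if z == x then f x - eps / 2 else f z.
have g_dom : dominates_dist g.
  move=> u v; rewrite /g; case: eqP => [->|_]; case: eqP => [->|_].
  - by have := far x; rewrite mdistxx; lra.
  - by have := far v; lra.
  - by have := far u; rewrite metric_sym; lra.
  - exact: f_dom.
have g_le z : g z <= f z by rewrite /g; case: eqP => [->|//]; lra.
by have /(congr1 (@^~ x)) := f_min g g_dom g_le; rewrite /g eqxx; lra.
Qed.

Lemma hull_dist_approx f g (eps : R) : X -> 0 < eps ->
  exists x, mdist f g < `|sval f x - sval g x| + eps.
Proof.
move=> x0 eps0; apply/not_existsP => far.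
have {}far x : `|sval f x - sval g x| <= mdist f g - eps.
  by rewrite lerBrDr leNgt; apply/negP; exact: far.
(* The point [x0] makes the bound nonnegative, as [hull_dist_le] requires. *)
have dist_ge0 := le_trans (normr_ge0 _) (far x0).
by have := hull_dist_le dist_ge0 far; rewrite -[hull_dist f g]/(mdist f g); lra.
Qed.

(** A point [x] nearly realizing the distance is the end next to whichever function is smaller at
    [x]; extremality of the other function yields the opposite end. Each choice costs one [eps]. *)
Lemma hull_almost_geodesic f g (eps : R) : X -> 0 < eps ->
  exists pq : X * X,
    sval f pq.1 + mdist f g + sval g pq.2 <= mdist pq.1 pq.2 + 2 * eps.
Proof.
move=> x0 eps0; have [x] := hull_dist_approx f g x0 eps0.
have [_|_] := ger0P (sval f x - sval g x) => near_x.
- have [y near_y] := extremal_approx x (svalP f) eps0.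
  by exists (y, x); rewrite /= (metric_sym y x); lra.
- have [y near_y] := extremal_approx x (svalP g) eps0.
  by exists (x, y); rewrite /=; lra.
Qed.

(** This is the triangle inequality along [x], [f], [g], [y] in E(X), where [sval f x] is the
    distance from [f] to the image of [x]. *)
Lemma mdist_le_hull f g x y : mdist x y <= sval f x + mdist f g + sval g y.
Proof.
have := (svalP f).1 x y; have := le_hull_dist f g y.
by rewrite -[hull_dist f g]/(mdist f g) ler_norml; lra.
Qed.

Lemma hyperbolic_hull_approx (n : nat) (delta eps : R)
    (F : signed_index n -> injective_hull X) :
  X -> 0 < eps -> hyperbolic n delta X ->
  exists2 alpha : {perm signed_index n}, alpha != sopp_perm n &
    \sum_i mdist (F i) (F (sopp i)) <=
    \sum_i mdist (F i) (F (alpha i)) + 2 * delta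
      + \sum_(i : signed_index n) 2 * eps.
Proof.
move=> x0 eps0 hypX.
(* Choosing by [k] rather than by signed index makes [i] and [sopp i] share one pair. *)
have [pq pqP] := choice (fun k : 'I_n.+1 =>
  hull_almost_geodesic (F (false, k)) (F (true, k)) x0 eps0).
pose x (i : signed_index n) := if i.1 then (pq i.2).2 else (pq i.2).1.
pose h i := sval (F i) (x i).
have lower i : h i + mdist (F i) (F (sopp i)) + h (sopp i)
    <= mdist (x i) (x (sopp i)) + 2 * eps.
  case: i => [[] k]; rewrite /h /x /sopp /=; have := pqP k; last by [].
  by rewrite (metric_sym (F (true, k))) (metric_sym (pq k).2); lra.
have [alpha alphaN le_alpha] := hypX x; exists alpha => //.
have lower_sum := ler_sum (index_enum _) (fun i (_ : true) => lower i).
have upper i : mdist (x i) (x (alpha i))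
    <= h i + mdist (F i) (F (alpha i)) + h (alpha i) by exact: mdist_le_hull.
have upper_sum := ler_sum (index_enum _) (fun i (_ : true) => upper i).
have sum_sopp : \sum_i h (sopp i) = \sum_i h i.
  by rewrite [RHS](reindex_inj (inv_inj (@soppK n))).
have sum_alpha : \sum_i h (alpha i) = \sum_i h i.
  by rewrite [RHS](reindex_inj (@perm_inj _ alpha)).
by move: lower_sum upper_sum; rewrite !big_split /= sum_sopp sum_alpha; lra.
Qed.

Lemma hyperbolic_hull (n : nat) (delta : R) : X ->
  hyperbolic n delta X -> hyperbolic n delta (injective_hull X).
Proof.
move=> x0 hypX F.
have [alpha0 alpha0N _] := hyperbolic_hull_approx F x0 ltr01 hypX.
pose S (alpha : {perm signed_index n}) := \sum_i mdist (F i) (F (alpha i)).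
(* The permutation obtained above depends on [eps]; a maximizer [beta] of [S] works for all [eps] at
   once. [alpha0] only witnesses that there are candidates. *)
have [beta betaN beta_max] :=
  @arg_maxP _ _ _ alpha0 [pred alpha | alpha != sopp_perm n] S alpha0N.
exists beta => //; apply/ler_addgt0Pr => e e0.
have N0 : 0 < #|{: signed_index n}|%:R :> R.
  by rewrite ltr0n; apply/card_gt0P; exists (false, ord0).
(* With this value the total error is exactly [e]. *)
pose eps := e / #|{: signed_index n}|%:R / 2.
have eps0 : 0 < eps by rewrite !divr_gt0.
have [alpha alphaN] := hyperbolic_hull_approx F x0 eps0 hypX.
have -> : \sum_(i : signed_index n) 2 * eps = e.
  by rewrite sumr_const -[LHS]mulr_natr /eps (mulrC 2) !divfK ?gt_eqF.
by have : S alpha <= S beta := beta_max alpha alphaN; rewrite /S; lra.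
Qed.

Lemma hyperbolic_hull_empty (n : nat) (delta : R) :
  0 <= delta -> (X -> False) -> hyperbolic n delta (injective_hull X).
Proof.
move=> delta0 X0 F; exists 1%g.
  apply/eqP => /permP /(_ (false, ord0)).
  by rewrite perm1 permE.
rewrite big1 => [|i _]; last first.
  apply/eqP; rewrite eq_le mdist_ge0 andbT.
  by apply: hull_dist_le => // x; case: (X0 x).
by rewrite addr_ge0 ?mulr_ge0 ?sumr_ge0 // => i _; exact: mdist_ge0.
Qed.

End Hull.

Theorem proposition4p1 (R : realType) (n : nat) (delta : R)
    (delta_ge0 : 0 <= delta) (X : metricType R) :
  hyperbolic n delta X <-> hyperbolic n delta (injective_hull X).
Proof.
split; last exact: hyperbolic_isometric mdist_hull_embed.
have [[x0 _]|X0] := pselect (exists x : X, True); first exact: hyperbolic_hull.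
by move=> _; apply: hyperbolic_hull_empty => // x; apply: X0; exists x.
Qed.
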